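(* Let $\mathcal{A}$ be a unital $C^*$-algebra and let $a,b\in\mathcal{A}$. Then $$\|a+b\|_{\nabla}\le\|a\|_{\nabla}+\|b\|_{\nabla}.$$
   Context: $\mathcal{A}$ is a unital $C^*$-algebra with unit $1$, and $\mathcal{S}(\mathcal{A})=\{f\in\mathcal{A}': f(1)=\|f\|=1\}$ is its set of states. With $\nabla$ the arithmetic mean $s\nabla t=\frac{s+t}{2}$, for $a\in\mathcal{A}$, $$\|a\|_{\nabla}=\sup\left\{\sqrt{\tfrac12\left(|f(a)|^2+f(a^*a)\right)}: f\in\mathcal{S}(\mathcal{A})\right\}.$$ *)

(* Defs.v *)
From HB Require Import structures.
From mathcomp Require Import all_boot all_order all_algebra.
From mathcomp Require Import complex.
From mathcomp Require Import boolp classical_sets reals topology normedtype.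

Set Implicit Arguments.
Unset Strict Implicit.
Unset Printing Implicit Defensive.

Import Order.TTheory GRing.Theory Num.Theory.
Import numFieldNormedType.Exports.

Local Open Scope classical_set_scope.
Local Open Scope ring_scope.

(* A structure inheriting from both [Num.NormedZmodule] and [GRing.PzSemiRing]
   would lack a join with [Num.NumDomain], so the norm is a fresh operation on
   an [algType], and the alias [normed_space A] carries the [normedModType]
   (topology, completeness) that it induces.  As [algType] is built on
   [nzRingType], algebras satisfy [1 != 0]. *)
HB.mixin Record Algebra_isNormed (K : numFieldType) A & GRing.Algebra K A := {
  alg_norm : A -> K;
  alg_normD : forall x y : A, alg_norm (x + y) <= alg_norm x + alg_norm y;
  alg_normZ : forall (k : K) (x : A), alg_norm (k *: x) = `|k| * alg_norm x;
  alg_norm0_eq0 : forall x : A, alg_norm x = 0 -> x = 0;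
  alg_normM : forall x y : A, alg_norm (x * y) <= alg_norm x * alg_norm y
}.

#[short(type="normedAlgType")]
HB.structure Definition NormedAlgebra (K : numFieldType) :=
  {A of GRing.Algebra K A & Algebra_isNormed K A}.

Definition normed_space (K : numFieldType) (A : normedAlgType K) : Type := A.

HB.instance Definition _ (K : numFieldType) (A : normedAlgType K) :=
  GRing.Lmodule.copy (normed_space A) A.

HB.instance Definition _ (K : numFieldType) (A : normedAlgType K) :=
  @Lmodule_isNormed.Build K (normed_space A) (@alg_norm K A)
    (@alg_normD K A) (@alg_normZ K A) (@alg_norm0_eq0 K A).

HB.mixin Record NormedAlgebra_isCStar (R : realType) A
    & NormedAlgebra R[i] A := {
  alg_cauchy_cvg : forall F : set_system (normed_space A),
    ProperFilter F -> cauchy F -> cvg F;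
  star : A -> A;
  starK : involutive star;
  starD : {morph star : x y / x + y};
  starZ : forall (k : R[i]) (x : A), star (k *: x) = k^* *: star x;
  starM : forall x y : A, star (x * y) = star y * star x;
  alg_norm_starM : forall x : A, alg_norm (star x * x) = alg_norm x ^+ 2
}.

#[short(type="cstarAlgType")]
HB.structure Definition CStarAlgebra (R : realType) :=
  {A of NormedAlgebra R[i] A & NormedAlgebra_isCStar R A}.

HB.instance Definition _ (R : realType) (A : cstarAlgType R) :=
  Uniform_isComplete.Build (normed_space A) (@alg_cauchy_cvg R A).

(* Norms over [R[i]] are [R[i]]-valued; [csup E] is the real supremum of the
   real elements of [E]. *)
Definition csup (R : realType) (E : set R[i]) : R :=
  sup [set r : R | E (real_complex R r)].

Definition dual_norm (R : realType) (V : normedModType R[i])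
    (f : {linear V -> R[i]^o}) : R :=
  csup [set `|f x| | x in [set x : V | `|x| <= 1]].

Definition states (R : realType) (A : cstarAlgType R) :=
  [set f : {linear normed_space A -> R[i]^o} |
     [/\ continuous f, f (1 : A) = 1 & dual_norm f = 1]].

Arguments states {R} A _.

Definition nabla_norm (R : realType) (A : cstarAlgType R) (a : A) : R :=
  csup [set sqrtC (2^-1 * (`|f a| ^+ 2 + f (star a * a)))
       | f in states A].

(* Main.v *)
(* For a state [f], the number [|f a|^2 + f (star a * a)] is twice the value at
   [a] of a positive quadratic form, so its square root obeys the triangle
   inequality and one takes suprema. Everything rests on [0 <= f (star a * a)],
   which is obtained from the norm alone, without spectral theory.

   Call a self-adjoint [h] positive if [nm (t - h) <= t] for some real [t >= 0];
   such [h] form a cone on which states are nonnegative.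
   - For self-adjoint [k], [1 + nm k <= max (nm (1 + k)) (nm (1 - k))]: the
     maximum bounds [nm (1 + z *: k)] on the unit circle, and averaging
     [(1 + z *: k) ^+ n] over roots of unity isolates each [nm k ^+ j *+ 'C(n, j)].
     Hence a positive [h] with [nm h <= 2 * t] satisfies [nm (t - h) <= t], and
     squares of self-adjoint elements are positive.
   - If [1 - star b * b] is positive then [nm b <= 1]: otherwise rescale to
     [nm b = 1] with [star b * b <= eta < 1]; then [b * star b >= - eta], since the
     sum of the two is positive, and this contradicts
     [u ^+ 2 * (1 - u) = star b * (v * (1 - v)) * b] for [u := star b * b] and
     [v := b * star b].
   - If [nm a <= 1], [h := star a * a] and [nm (1 - h) = 1 + d], then
     [b := sqrt 2 a (1 - h)] again has norm at most 1 and
     [1 + 2 * d <= nm (1 - star b * b)]. Iterating, [d <= 0]. *)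
Require Import Defs.
From mathcomp Require Import all_boot all_order all_algebra.
From mathcomp Require Import complex boolp classical_sets reals normedtype.
From mathcomp Require Import ring lra.

Set Implicit Arguments.
Unset Strict Implicit.
Unset Printing Implicit Defensive.

Import Order.TTheory GRing.Theory Num.Theory.

Local Open Scope ring_scope.
Local Open Scope complex_scope.

(** * The real-valued norm, scalars and the involution *)

Section RealNorm.
Context (R : realType) (A : cstarAlgType R).
Implicit Types (x y h k : A) (s t : R) (z : R[i]).

(** [alg_norm] takes values in [R[i]]; its real part lets the estimates run over the ordered field
    [R]. *)
Definition nm x : R := complex.Re (alg_norm x).

Lemma nmE x : alg_norm x = (nm x)%:C.
Proof.
by rewrite /nm RRe_real //; exact: ger0_real (normr_ge0 (x : normed_space A)).
Qed.

Lemma nm_ge0 x : 0 <= nm x.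
Proof. by rewrite -ler0c -nmE; exact: (normr_ge0 (x : normed_space A)). Qed.

Lemma nm_eq0 x : nm x = 0 -> x = 0.
Proof. by move=> x0; apply: alg_norm0_eq0; rewrite nmE x0. Qed.

Lemma nmD x y : nm (x + y) <= nm x + nm y.
Proof.
by have := alg_normD x y; rewrite !nmE -(rmorphD (real_complex R)) lecR.
Qed.

Lemma nmM x y : nm (x * y) <= nm x * nm y.
Proof.
by have := alg_normM x y; rewrite !nmE -(rmorphM (real_complex R)) lecR.
Qed.

Lemma nmZ z x : (nm (z *: x))%:C = `|z| * (nm x)%:C.
Proof. by rewrite -!nmE alg_normZ. Qed.

Lemma nmMn x n : nm (x *+ n) = nm x *+ n.
Proof.
apply: complexI; rewrite -scaler_nat nmZ normr_nat mulr_natl.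
by rewrite (raddfMn (real_complex R)).
Qed.

Lemma nmN x : nm (- x) = nm x.
Proof. by apply: complexI; rewrite -scaleN1r nmZ normrN1 mul1r. Qed.

Lemma nmB x y : nm (x - y) <= nm x + nm y.
Proof. by rewrite -(nmN y) nmD. Qed.

Lemma nm0 : nm 0 = 0.
Proof. by apply: complexI; rewrite -(scale0r 0) nmZ normr0 mul0r. Qed.

Lemma nm_starM x : nm (star x * x) = nm x ^+ 2.
Proof.
by apply: complexI; rewrite -nmE alg_norm_starM nmE (rmorphXn (real_complex R)).
Qed.

Lemma star1 : star (1 : A) = 1.
Proof. by have := starM (star (1 : A)) 1; rewrite mulr1 starK mulr1. Qed.

Lemma nm1 : nm 1 = 1.
Proof.
have := nm_starM 1; rewrite star1 mulr1 expr2 => e.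
have n0 : nm 1 != 0 by apply/eqP => /nm_eq0/eqP; rewrite oner_eq0.
by apply/esym/(mulfI n0); rewrite mulr1.
Qed.

Lemma nm_sum (I : Type) (r : seq I) (P : pred I) (F : I -> A) :
  nm (\sum_(i <- r | P i) F i) <= \sum_(i <- r | P i) nm (F i).
Proof.
elim/big_rec2: _ => [|i u x _ le_xu]; first by rewrite nm0.
by rewrite (le_trans (nmD _ _)) // lerD2l.
Qed.

Lemma nmX x n : nm (x ^+ n) <= nm x ^+ n.
Proof.
elim: n => [|n IHn]; first by rewrite !expr0 nm1.
by rewrite !exprS (le_trans (nmM _ _)) // ler_wpM2l ?nm_ge0.
Qed.

Local Notation "t %:S" := ((t%:C)%:A) (at level 1, format "t %:S").

Lemma nmSl t x : nm (t%:S * x) = `|t| * nm x.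
Proof.
apply: complexI; rewrite mulr_algl nmZ (rmorphM (real_complex R)) /=.
by rewrite normc_def /= expr0n addr0 sqrtr_sqr.
Qed.

Lemma nmS t : nm (t%:S) = `|t|.
Proof. by rewrite -[t%:S]mulr1 nmSl nm1 mulr1. Qed.

Lemma starN x : star (- x) = - star x.
Proof. by rewrite -scaleN1r starZ rmorphN1 scaleN1r. Qed.

Lemma starB x y : star (x - y) = star x - star y.
Proof. by rewrite starD starN. Qed.

Lemma starA z : star (z%:A : A) = (Num.conj z)%:A.
Proof. by rewrite starZ star1. Qed.

Lemma starS t : star (t%:S : A) = t%:S.
Proof. by rewrite starA conj_Creal //; apply/complex_realP; exists t. Qed.

Lemma starX x n : star (x ^+ n) = star x ^+ n.
Proof.
elim: n => [|n IHn]; first by rewrite !expr0 star1.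
by rewrite exprS starM IHn exprSr.
Qed.

Lemma nm_star x : nm (star x) = nm x.
Proof.
suff le y : nm y <= nm (star y).
  by apply/le_anti; rewrite le andbT -{2}[x]starK le.
have [->|/eqP y0] := eqVneq (nm y) 0; first exact: nm_ge0.
have yp : 0 < nm y by rewrite lt0r nm_ge0 andbT; apply/eqP.
by rewrite -(ler_pM2r yp) -expr2 -nm_starM nmM.
Qed.

Lemma nm_sa_sqr h : star h = h -> nm (h ^+ 2) = nm h ^+ 2.
Proof. by move=> hs; rewrite -nm_starM hs. Qed.

Lemma nm_sa_exp2 h n : star h = h -> nm (h ^+ (2 ^ n)) = nm h ^+ (2 ^ n).
Proof.
move=> hs; elim: n => [|n IHn]; first by rewrite !expr1.
by rewrite expnSr !exprM nm_sa_sqr ?IHn // starX hs.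
Qed.

(** The C*-identity settles the exponents [2 ^ n]. Splitting [h ^+ (2 ^ n)] as
    [h ^+ n * h ^+ (2 ^ n - n)] and cancelling a power of [nm h] gives the rest. *)
Lemma nm_saX h n : star h = h -> nm (h ^+ n) = nm h ^+ n.
Proof.
move=> hs; apply/le_anti; rewrite nmX /=.
have [->|/eqP h0] := eqVneq h 0.
  by case: n => [|n]; rewrite ?expr0 ?nm1 // !exprS mul0r nm0 mul0r.
have hp : 0 < nm h.
  by rewrite lt0r nm_ge0 andbT; apply/eqP => /nm_eq0.
have le_n : (n <= 2 ^ n)%N by exact: ltnW (ltn_expl n (ltnSn 1)).
rewrite -(ler_pM2r (exprn_gt0 (2 ^ n - n) hp)) -exprD subnKC //.
rewrite -nm_sa_exp2 // -{1}(subnKC le_n) exprD (le_trans (nmM _ _)) //.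
by rewrite ler_wpM2l ?nm_ge0 ?nmX.
Qed.

(** * The norm of a self-adjoint element *)

(** A [2 ^ n]-th root of -1 has order dividing [2 ^ n.+1] but not [2 ^ n]. *)
Lemma prim_root_exp2_exists n : exists w : R[i], (2 ^ n.+1).-primitive_root w.
Proof.
set w : R[i] := (2 ^ n).-root (-1).
have w1 : w ^+ (2 ^ n) = -1 by rewrite rootCK // expn_gt0.
have w2 : w ^+ (2 ^ n.+1) = 1 by rewrite expnSr exprM w1 sqrrN expr1n.
have [m wm] := prim_order_exists (expn_gt0 2 n.+1) w2.
case/dvdn_pfactor => // j; rewrite leq_eqVlt => /predU1P[-> mE|].
  by exists w; rewrite -mE.
rewrite ltnS => jn mE; have : w ^+ (2 ^ n) == 1.
  by rewrite -(prim_order_dvd wm) mE dvdn_exp2l.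
by rewrite w1 eq_sym -subr_eq0 opprK -(natrD _ 1 1) pnatr_eq0.
Qed.

Lemma unity_root_norm1 n (w : R[i]) : (0 < n)%N -> w ^+ n = 1 -> `|w| = 1.
Proof.
move=> n0 wn; apply/eqP; rewrite -(pexpr_eq1 n0) ?normr_ge0 //.
by rewrite -normrX wn normr1.
Qed.

(** Discrete Fourier inversion: averaging [z ^- j] times the polynomial over the [m]-th roots of
    unity leaves only [p j], as [m > n] keeps distinct exponents distinct modulo [m]. *)
Lemma coef_bound n (p : nat -> A) M :
    (forall z, `|z| = 1 -> nm (\sum_(j < n) z ^+ j *: p j) <= M) ->
  forall j, (j < n)%N -> nm (p j) <= M.
Proof.
move=> pM j jn; have [w wP] := prim_root_exp2_exists n.
set m := (2 ^ n.+1)%N in wP; have m0 : (0 < m)%N by rewrite expn_gt0.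
have nm_lt : (n < m)%N := ltn_trans (ltnSn n) (ltn_expl n.+1 (ltnSn 1)).
have wm := prim_expr_order wP.
have w_neq0 : w != 0 by rewrite -normr_gt0 (unity_root_norm1 m0 wm).
have E : p j *+ m =
    \sum_(i < m) (w ^+ i) ^- j *: \sum_(l < n) (w ^+ i) ^+ l *: p l.
  under eq_bigr do rewrite scaler_sumr.
  rewrite exchange_big /= (bigD1 (Ordinal jn)) //= [X in _ + X]big1 ?addr0;
    last first.
    move=> l /eqP lj; under eq_bigr do rewrite scalerA.
    rewrite -scaler_suml; set v := w ^- j * w ^+ l.
    rewrite (eq_bigr (fun i : 'I_m => v ^+ i)); last first.
      by move=> i _; rewrite /v exprMn exprVn -!exprM mulnC [(l * _)%N]mulnC.
    have v1 : v - 1 != 0.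
      rewrite subr_eq0; apply/eqP => v1; apply: lj; apply/val_inj => /=.
      have : w ^+ l = w ^+ j.
        by rewrite -[RHS]mulr1 -v1 /v mulrA divff ?mul1r // expf_neq0.
      move/eqP; rewrite (eq_prim_root_expr wP) !modn_small => [/eqP//||].
        exact: ltn_trans jn nm_lt.
      exact: ltn_trans (ltn_ord l) nm_lt.
    rewrite (_ : \sum_(i < m) _ = 0) ?scale0r //.
    apply/(mulfI v1); rewrite -subrX1 mulr0 /v exprMn exprVn -!exprM.
    by rewrite mulnC exprM wm expr1n invr1 mul1r mulnC exprM wm expr1n subrr.
  under eq_bigr => i _.
    rewrite scalerA mulVf ?scale1r; last by rewrite !expf_neq0.
    over.
  by rewrite sumr_const card_ord.
have : nm (p j *+ m) <= \sum_(i < m) M.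
  rewrite E (le_trans (nm_sum _ _ _)) // ler_sum // => i _.
  have wi : `|w ^+ i| = 1 by rewrite normrX (unity_root_norm1 m0 wm) expr1n.
  rewrite (_ : nm (_ *: _) = nm (\sum_(l < n) w ^+ i ^+ l *: p l)) ?pM //.
  by apply: complexI; rewrite nmZ normrV ?unitfE ?expf_neq0 // normrX wi;
    rewrite expr1n invr1 mul1r.
by rewrite nmMn sumr_const card_ord lerMn2r eqn0Ngt m0.
Qed.

Lemma realS1 : 1%:S = 1 :> A.
Proof. exact: scale1r. Qed.

Lemma realSM s t : (s * t)%:S = s%:S * t%:S :> A.
Proof. by rewrite mulr_algl scalerA -(rmorphM (real_complex R)). Qed.

Lemma realSE :
  ((forall n, n%:R%:S = n%:R :> A)%R * (forall s t, (s + t)%:S = s%:S + t%:S :> A)%R *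
   (forall t, (- t)%:S = - t%:S :> A)%R *
   (forall s t, (s * t)%:S = s%:S * t%:S :> A)%R * (1%:S = 1 :> A)%R)%type.
Proof.
pose f : {rmorphism R -> A} := GRing.in_alg A \o real_complex R.
split; last exact: (rmorph1 f); split; last exact: (rmorphM f).
split; last exact: (rmorphN f); split; last exact: (rmorphD f).
exact: (rmorph_nat f).
Qed.

(* Identities between polynomials in a single element of [A], where [ring] does not
   apply, are proved in [{poly R[i]}] and transported by [horner_alg]. *)
Lemma halgE k :
  ((forall n, horner_alg k n%:R = n%:R)%R *
   (forall p q, horner_alg k (p + q) = horner_alg k p + horner_alg k q)%R *
   (forall p, horner_alg k (- p) = - horner_alg k p)%R *
   (forall p n, horner_alg k (p ^+ n) = horner_alg k p ^+ n)%R *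
   (forall p q, horner_alg k (p * q) = horner_alg k p * horner_alg k q)%R *
   (horner_alg k 1 = 1)%R *
   (forall c, horner_alg k c%:P = c%:A)%R * (horner_alg k 'X = k)%R)%type.
Proof.
split; last exact: horner_algX; split; last exact: horner_algC.
split; last exact: rmorph1; split; last exact: rmorphM.
split; last by move=> p n; exact: rmorphXn.
split; last exact: rmorphN; split; last exact: rmorphD.
exact: rmorph_nat.
Qed.

(* [nm (1 + z *: k) ^+ 2] is affine in the real part of [z] on the unit circle,
   so it is maximal at [z = 1] or [z = -1]. *)
Lemma nm_circle k M z : star k = k ->
  nm (1 + k) <= M -> nm (1 - k) <= M -> `|z| = 1 -> nm (1 + z *: k) <= M.
Proof.
move=> ks kp km z1; have M0 : 0 <= M by rewrite (le_trans _ kp) ?nm_ge0.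
rewrite -(@ler_pXn2r _ 2) ?nnegrE ?nm_ge0 // -nm_starM starD star1 starZ ks.
have zz : Num.conj z * z = 1 by rewrite mulrC -normCK z1 expr1n.
have zD : Num.conj z + z = (2 * complex.Re z)%:C.
  by rewrite addrC addcJ (rmorphM (real_complex R)) rmorph_nat.
set x := complex.Re z in zD.
pose a := (1 + x) / 2; have xa : 2 * x = 4 * a - 2 by rewrite /a; field.
have [a0 a1] : 0 <= a /\ 0 <= 1 - a.
  have : `|x| <= 1 by rewrite -lecR -[X in _ <= X]z1 normc_ge_Re.
  by rewrite ler_norml /a; split; lra.
clearbody a.
have -> : (1 + Num.conj z *: k) * (1 + z *: k)
    = a%:S * (1 + k) ^+ 2 + (1 - a)%:S * (1 - k) ^+ 2.
  rewrite mulrDl mulrDr mulr1 mul1r -addrA (addrC (z *: k)) mulrDr mulr1.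
  rewrite -scalerAl -scalerAr scalerA zz scale1r -[in LHS]addrA.
  rewrite [in LHS](addrC (k * k)) [in LHS](addrA (_ *: k)) -scalerDl zD xa.
  have E : 1 + ((4 * a%:C%:P - 2) * 'X + 'X * 'X) =
    a%:C%:P * (1 + 'X) ^+ 2 + (1 - a%:C%:P) * (1 - 'X) ^+ 2 :> {poly R[i]} by ring.
  move: E => /(congr1 (horner_alg k)); rewrite !halgE => E.
  by rewrite -[_ *: k]mulr_algl !realSE E.
have x2 : 0 <= M ^+ 2 by rewrite exprn_ge0.
rewrite (le_trans (nmD _ _)) // !nmSl !ger0_norm //.
have -> : M ^+ 2 = a * M ^+ 2 + (1 - a) * M ^+ 2 by ring.
apply: lerD; apply: ler_wpM2l => //.
  by rewrite (le_trans (nmX _ _)) // ler_pXn2r ?nnegrE ?nm_ge0.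
by rewrite (le_trans (nmX _ _)) // ler_pXn2r ?nnegrE ?nm_ge0.
Qed.

(** Put [L = M * (1 + e)]. Bernoulli's inequality squared gives
    [(1 + e) ^+ (2 * n) >= (1 + n * e) ^+ 2], which exceeds [2 * n + 1] once [n * e ^+ 2 > 2]. *)
Lemma exp_gt_linear (L M : R) : 1 <= M -> M < L ->
  exists n, n.+1%:R * M ^+ n < L ^+ n.
Proof.
move=> M1 ML; have M0 : 0 < M by lra.
pose e := L / M - 1; have e0 : 0 < e by rewrite subr_gt0 ltr_pdivlMr ?mul1r.
have LE : L = M * (1 + e) by rewrite /e; field; rewrite gt_eqF.
have bern n : 1 + n%:R * e <= (1 + e) ^+ n.
  elim: n => [|n IHn]; first by rewrite expr0 mul0r addr0.
  have : 0 <= n%:R * e * e by rewrite !mulr_ge0 // ltW.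
  rewrite exprS -natr1 => ?; have := ler_wpM2l (ltW (ltr_wpDl ler01 e0)) IHn; nra.
pose n := (Num.trunc (2 / e ^+ 2)).+1.
have nP : 2 < n%:R * e ^+ 2.
  by rewrite -ltr_pdivrMr ?exprn_gt0 // truncnS_gt.
exists (n * 2)%N; rewrite LE exprMn mulrC ltr_pM2l ?exprn_gt0 // [ltRHS]exprM.
have n0 : 0 < n%:R :> R by rewrite ltr0n.
have ne : 0 < n%:R * e by rewrite mulr_gt0.
rewrite (@lt_le_trans _ _ ((1 + n%:R * e) ^+ 2)) //; last first.
  by rewrite ler_pXn2r ?nnegrE ?bern // ?exprn_ge0 //; lra.
rewrite -natr1 natrM; nra.
Qed.

(** Each of the [n.+1] binomial terms of [(1 + nm k) ^+ n] is at most [M ^+ n]; for large [n] this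
    excludes [M < 1 + nm k]. *)
Lemma nm_sa_1D k M : star k = k ->
  nm (1 + k) <= M -> nm (1 - k) <= M -> 1 + nm k <= M.
Proof.
move=> ks kp km; rewrite leNgt; apply/negP => Mk.
have M1 : 1 <= M.
  have := nmD (1 + k) (1 - k); rewrite addrACA subrr addr0 -mulr2n nmMn nm1.
  by move=> h2; lra.
have [n] := exp_gt_linear M1 Mk; apply/negP; rewrite -leNgt.
have M0 : 0 <= M by lra.
have bound : forall j, (j < n.+1)%N -> nm k ^+ j *+ 'C(n, j) <= M ^+ n.
  move=> j jn; rewrite -nm_saX // -nmMn; move: j jn.
  apply: coef_bound => z z1.
  rewrite (_ : \sum_(_ < _) _ = (1 + z *: k) ^+ n).
    rewrite (le_trans (nmX _ _)) // lerXn2r ?nnegrE ?nm_ge0 //.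
    exact: nm_circle.
  rewrite exprDn_comm; last exact/commr_sym/commr1.
  by apply: eq_bigr => i _; rewrite expr1n mul1r exprZn scalerMnr.
rewrite exprDn; apply: (@le_trans _ _ (\sum_(i < n.+1) M ^+ n)).
  by apply: ler_sum => i _; rewrite expr1n mul1r bound.
by rewrite sumr_const card_ord mulr_natl.
Qed.

Lemma nm_sa_SD (u : A) t M : star u = u -> 0 <= t ->
  nm (t%:S + u) <= M -> nm (t%:S - u) <= M -> t + nm u <= M.
Proof.
move=> us; rewrite le_eqVlt => /predU1P[<-|t0].
  by rewrite (_ : 0%:C = 0) // scale0r !add0r.
have tt : t%:S * t^-1%:S = 1 :> A.
  by rewrite -realSM divff ?gt_eqF // (_ : 1%:C = 1) ?scale1r.
have E (v : A) : t%:S + v = t%:S * (1 + t^-1%:S * v).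
  by rewrite mulrDr mulr1 mulrA tt mul1r.
rewrite !E mulrN !nmSl gtr0_norm // -!ler_pdivlMl // => up um.
have := nm_sa_1D _ up um; rewrite starM starS us nmSl normfV gtr0_norm //.
rewrite ler_pdivlMl // mulrDr mulr1 mulrA divff ?gt_eqF // mul1r; apply.
by rewrite mulr_algl mulr_algr.
Qed.

(** * The positive cone *)

(** In spectral terms, the norm condition places the spectrum of the self-adjoint [h] in the
    interval from 0 to [2 * t]. *)
Definition pos h := star h = h /\ exists2 t : R, 0 <= t & nm (t%:S - h) <= t.

Lemma nmSB_mono h s t : s <= t -> nm (s%:S - h) <= s -> nm (t%:S - h) <= t.
Proof.
move=> st hs; have -> : t%:S - h = (t - s)%:S + (s%:S - h) :> A.
  by rewrite !realSE addrA subrK.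
by rewrite (le_trans (nmD _ _)) // nmS ger0_norm ?subr_ge0 //; lra.
Qed.

Lemma posD h k : pos h -> pos k -> pos (h + k).
Proof.
move=> [hs [s s0 hsle]] [ks [t t0 ktle]]; split; first by rewrite starD hs ks.
exists (s + t); first exact: addr_ge0.
by rewrite !realSE opprD addrACA (le_trans (nmD _ _)) ?lerD.
Qed.

Lemma posZ t h : 0 <= t -> pos h -> pos (t%:S * h).
Proof.
move=> t0 [hs [s s0 hsle]]; split.
  by rewrite starM hs starS mulr_algl mulr_algr.
exists (t * s); first exact: mulr_ge0.
by rewrite realSM -mulrBr nmSl ger0_norm ?ler_wpM2l.
Qed.

(** Apply [nm_sa_SD] to [t - h] with scalar [r - t] and bound [r]: the sum is [r - h], the
    difference [(r - 2 * t) + h]. *)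
Lemma pos_nm h t : pos h -> nm h <= 2 * t -> nm (t%:S - h) <= t.
Proof.
move=> [hs [s s0 hsle]] ht; have h0 := nm_ge0 h.
pose r := s + 2 * t; have rE : r = s + 2 * t by []; clearbody r.
have us : star (t%:S - h) = t%:S - h by rewrite starB starS hs.
suff : r - t + nm (t%:S - h) <= r by move=> ?; lra.
apply: nm_sa_SD => //; first by lra.
  rewrite [X in nm X](_ : _ = r%:S - h); last by rewrite !realSE addrA subrK.
  by apply: nmSB_mono hsle; lra.
rewrite [X in nm X](_ : _ = (r - 2 * t)%:S + h); last first.
  by rewrite mulr_natl mulr2n !realSE opprB addrA addrAC opprD addrA.
rewrite (le_trans (nmD _ _)) // nmS ger0_norm; lra.
Qed.

Lemma pos_SB h t : star h = h -> nm h <= t -> pos (t%:S - h).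
Proof.
move=> hs ht; split; first by rewrite starB starS hs.
by exists t; rewrite ?(le_trans (nm_ge0 h)) // opprB addrCA subrr addr0.
Qed.

(** The concave square root lies below its tangent at [t ^+ 2]. *)
Lemma le_sqr_tangent (t c : R) : 0 < t -> 0 <= c ->
  forall x : R, 0 <= x -> x ^+ 2 <= t ^+ 2 + c -> x <= t + c / (2 * t).
Proof.
move=> t0 c0 x x0 xle; have e0 : 0 <= c / (2 * t) by rewrite divr_ge0 //; lra.
rewrite -(@ler_pXn2r _ 2) ?nnegrE //; last by lra.
apply: le_trans xle _; set e := c / _ in e0 *.
have <- : 2 * t * e = c by rewrite /e; field; rewrite gt_eqF.
by nra.
Qed.

(* [t - h * h] is the self-adjoint part of [w := t - h * h + 'i sqrt (2 * t) h], and
   [star w * w = t ^+ 2 + h ^+ 4]. *)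
Lemma nmSB_sqr h t : star h = h -> 0 < t ->
  nm (t%:S - h * h) <= t + nm h ^+ 4 / (2 * t).
Proof.
move=> hs t0; apply: le_sqr_tangent; rewrite ?exprn_ge0 ?nm_ge0 //.
set a := t%:S - h * h; have as_ : star a = a by rewrite starB starS starM hs.
pose z : R[i] := 'i%R * (Num.sqrt (2 * t))%:C.
have zc : Num.conj z = - z.
  rewrite /z (rmorphM Num.conj) /= conjCi mulNr conj_Creal //.
  by apply/complex_realP; exists (Num.sqrt (2 * t)).
have z2 : z * z = - (2 * t)%:C.
  rewrite /z mulrACA -!expr2 sqrCi mulN1r -(rmorphXn (real_complex R)) /=.
  by rewrite sqr_sqrtr //; lra.
have ha : h * a = a * h by rewrite /a mulrBl mulrBr mulr_algl mulr_algr mulrA.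
have aE : a = t%:S - h * h by []; clearbody a z.
have ws : star (a + z *: h) = a - z *: h.
  by rewrite starD starZ zc hs as_ scaleNr.
have a_le : nm a <= nm (a + z *: h).
  rewrite -(ler_pM2l (ltr0n R 2)) !mulr_natl -nmMn mulr2n.
  have -> : a + a = (a + z *: h) + star (a + z *: h) by rewrite ws [RHS]addrACA subrr addr0.
  by rewrite (le_trans (nmD _ _)) // nm_star -mulr2n.
apply: (@le_trans _ _ (nm (a + z *: h) ^+ 2)).
  by rewrite lerXn2r ?nnegrE ?nm_ge0.
rewrite -nm_starM ws mulrBl !mulrDr -!scalerAl -!scalerAr ha scalerA z2.
have -> : a * a + z *: (a * h) - (z *: (a * h) + (- (2 * t)%:C) *: (h * h))
   = (t ^+ 2)%:S + h ^+ 4.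
  rewrite opprD addrA addrK scaleNr opprK -[_ *: (h * h)]mulr_algl aE expr2 !realSE.
  have E : (t%:C%:P - 'X * 'X) * (t%:C%:P - 'X * 'X) + 2 * t%:C%:P * ('X * 'X)
    = t%:C%:P * t%:C%:P + 'X ^+ 4 :> {poly R[i]} by ring.
  by move: E => /(congr1 (horner_alg h)); rewrite !halgE.
rewrite (le_trans (nmD _ _)) // nmS normrX gtr0_norm // lerD2l.
exact: nmX.
Qed.

Lemma pos_sqr h : star h = h -> pos (h * h).
Proof.
move=> hs; split; first by rewrite starM hs.
set c := nm h; have c0 : 0 <= c := nm_ge0 h.
exists (c ^+ 2); first exact: exprn_ge0.
have us : star ((c ^+ 2)%:S - h * h) = (c ^+ 2)%:S - h * h.
  by rewrite starB starS starM hs.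
(* In [nm_sa_SD] with scalar [a], [a >= c ^+ 2] handles the difference, and [a >= c ^+ 4 / e] keeps
   the error [c ^+ 4 / (2 * (a + c ^+ 2))] from [nmSB_sqr] at most [e]. *)
apply/ler_addgt0Pr => e e0; pose a := c ^+ 2 + 1 + c ^+ 4 / e.
have aE : a = c ^+ 2 + 1 + c ^+ 4 / e by []; clearbody a.
have c2 : 0 <= c ^+ 2 by rewrite exprn_ge0.
have ce : 0 <= c ^+ 4 / e by rewrite divr_ge0 ?exprn_ge0 // ltW.
rewrite -(lerD2l a) addrA; apply: nm_sa_SD => //; first by lra.
  rewrite [X in nm X](_ : _ = (a + c ^+ 2)%:S - h * h); last by rewrite !realSE addrA.
  apply: le_trans (nmSB_sqr hs _) _; first by lra.
  rewrite lerD2l ler_pdivrMr; last by lra.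
  have -> : nm h ^+ 4 = c ^+ 4 / e * e by rewrite mulfVK ?gt_eqF.
  by nra.
rewrite [X in nm X](_ : _ = (a - c ^+ 2)%:S + h * h); last first.
  by rewrite !realSE opprB addrA addrAC.
rewrite (le_trans (nmD _ _)) // nmS ger0_norm; last by lra.
by have := nmM h h; rewrite -/c -expr2; lra.
Qed.

(** * Positivity of [star x * x] *)

Lemma starM_sa x : star (star x * x) = star x * x.
Proof. by rewrite starM starK. Qed.

Lemma natSE n : n%:R = n%:R%:S :> A.
Proof. by rewrite realSE. Qed.

Lemma nm_natl n x : nm (n%:R * x) = n%:R * nm x.
Proof. by rewrite natSE nmSl normr_nat. Qed.

Lemma pos_half h : pos (2 * h) -> pos h.
Proof.
move=> h2; rewrite (_ : h = 2^-1%:S * (2 * h)); first by apply: posZ; rewrite ?invr_ge0.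
by rewrite [in 2 * h]natSE mulrA -realSM mulVf ?pnatr_eq0 // realSE mul1r.
Qed.

(* [p := x + star x] and [q := 'i *: (x - star x)] are self-adjoint, and twice the
   argument of [pos] is [p * p + q * q]. *)
Lemma pos_starMD x : pos (star x * x + x * star x).
Proof.
set y := star x; have yE : star y = x by rewrite /y starK.
have xE : star x = y by []; clearbody y.
pose q := ('i%R : R[i]) *: (x - y).
have qs : star q = q.
  by rewrite /q starZ conjCi starB yE xE scaleNr -scalerN opprB.
have ps : star (x + y) = x + y by rewrite starD yE xE addrC.
apply: pos_half; rewrite (_ : 2 * _ = (x + y) * (x + y) + q * q); last first.
  have i2 : 'i%R * 'i%R = -1 :> R[i] by rewrite -expr2 sqrCi.
  have pE : (x + y) * (x + y) = (x * x + y * y) + (y * x + x * y).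
    by rewrite mulrDl !mulrDr addrACA [RHS]addrACA [y * y + _]addrC.
  have qE : (x - y) * (x - y) = (x * x + y * y) - (y * x + x * y).
    by rewrite mulrBl !mulrBr opprB addrACA [in RHS]opprD [- (y * x) - _]addrC.
  rewrite /q -scalerAl -scalerAr scalerA i2 scaleN1r pE qE.
  by rewrite opprB [RHS]addrC [RHS]addrA subrK mulr_natl mulr2n.
by apply: posD; apply: pos_sqr.
Qed.

Lemma starM_S t x :
  star (t%:S * x) * (t%:S * x) = (t ^+ 2)%:S * (star x * x).
Proof.
rewrite starM starS -mulrA (mulrA t%:S) -realSM -expr2.
by rewrite mulr_algl -scalerAr mulr_algl.
Qed.

(** As [nm u = 1] and [nm (1 + u) < 2], [nm_sa_1D] forces [nm (1 - u) = 2], and then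
    [u * u * (1 - u)] has norm at least 2. Rewritten as [star x * (v * (1 - v)) * x], it has norm at
    most [1 + eta < 2]. *)
Lemma starM_lt1_not_pos x (eta : R) : nm x = 1 -> 0 <= eta -> eta < 1 ->
  ~ pos (eta%:S - star x * x).
Proof.
move=> x1 eta0 eta1; set u := star x * x; set v := x * star x => up.
have us : star u = u by rewrite starM_sa.
have u1 : nm u = 1 by rewrite nm_starM x1 expr1n.
have v1 : nm v = 1 by rewrite -[v]/(x * star x) -{1}[x]starK nm_starM nm_star x1 expr1n.
have nu : nm (1 + u) <= 1 + eta.
  rewrite (_ : 1 + u = (1 + eta)%:S - (eta%:S - u)); last first.
    by rewrite !realSE opprB addrA addrAC addrK.
  apply: pos_nm => //; rewrite (le_trans (nmB _ _)) // nmS u1 ger0_norm //; lra.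
have nv : nm (1 - v) <= 1 + eta.
  have pv : pos (eta%:S + v).
    rewrite (_ : _ + _ = (eta%:S - u) + (u + v)); last by rewrite addrA subrK.
    by apply: posD => //; exact: pos_starMD.
  rewrite (_ : 1 - v = (1 + eta)%:S - (eta%:S + v)); last first.
    by rewrite !realSE opprD addrA addrK.
  apply: pos_nm => //; rewrite (le_trans (nmD _ _)) // nmS v1 ger0_norm //; lra.
have uu : nm (u * u * (1 - u)) <= 1 + eta.
  rewrite (_ : _ * _ = star x * (v * (1 - v)) * x); last first.
    by rewrite !(mulrBr, mulrBl) !mulr1 /u /v !mulrA.
  rewrite (le_trans (nmM _ _)) // x1 mulr1 (le_trans (nmM _ _)) //.
  by rewrite nm_star x1 mul1r (le_trans (nmM _ _)) // v1 mul1r.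
set w := 1 - u in uu *.
have ws : star w = w by rewrite starB us star1.
have w2 : 2 <= nm w.
  rewrite leNgt; apply/negP => w2.
  have := nm_sa_1D (M := Num.max (1 + eta) (nm w)) us.
  rewrite !le_max nu lexx orbT u1 => /(_ isT isT).
  by case/orP => ?; lra.
have := nm_saX 3 ws.
(* [nm u = 1] and [nm (1 + u) < 2] force [nm w = 2], so the left side has norm [8]
   and the two terms on the right have norms less than [2] and at most [6]. *)
rewrite (_ : w ^+ 3 = u * u * w + w * (1 - 2 * u)); last first.
  have E : (1 - 'X) ^+ 3 = 'X * 'X * (1 - 'X) + (1 - 'X) * (1 - 2 * 'X)
    :> {poly R[i]} by ring.
  by move: E => /(congr1 (horner_alg u)); rewrite !halgE.
have := nmD (u * u * w) (w * (1 - 2 * u)).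
have := nmM w (1 - 2 * u).
have := nmB 1 (2 * u); rewrite nm_natl nm1 u1.
have := nmB 1 u; rewrite nm1 u1 -/w.
move: (nm w) (nm (u * u * w)) (nm (w * _)) (nm (1 - 2 * u)) (nm (_ + _)) w2 uu.
move=> W a b c d W2 a2 W2' c3 bW dab e; have {W2 W2'} WE : W = 2 by lra.
by subst W; lra.
Qed.

Lemma pos_1B_starM x : pos (1 - star x * x) -> nm x <= 1.
Proof.
move=> px; rewrite leNgt; apply/negP => x1; set c := nm x in x1.
have c0 : 0 < c by lra.
apply: (starM_lt1_not_pos (x := c^-1%:S * x) (eta := c^-2)).
- by rewrite nmSl ger0_norm ?invr_ge0 ?ltW // mulVf // gt_eqF.
- by rewrite invr_ge0 exprn_ge0 // ltW.
- by rewrite invf_lt1 ?exprn_gt0 // exprn_egt1.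
rewrite starM_S exprVn [X in pos X](_ : _ = (c^-2)%:S * (1 - star x * x)).
  by apply: posZ => //; rewrite invr_ge0 exprn_ge0 // ltW.
by rewrite mulrBr mulr1.
Qed.

(* With [h := star x * x] and [w := 1 - h], the element [y := sqrt 2 x w] has norm at
   most [1] because
   [2 * (1 - star y * y) = (1 - h ^+ 4) + w ^+ 4 + 2 * h ^+ 2]. *)
Lemma nm_1B_starM_le n x : nm x <= 1 -> nm (1 - star x * x) <= 1 + 2^-1 ^+ n.
Proof.
elim: n x => [|n IHn] x x1.
  rewrite (le_trans (nmB _ _)) // nm1 nm_starM expr0 lerD2l.
  by rewrite exprn_ile1 ?nm_ge0.
set h := star x * x; have hs : star h = h by rewrite starM_sa.
have h1 : nm h <= 1 by rewrite nm_starM exprn_ile1 ?nm_ge0.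
set w := 1 - h; have ws : star w = w by rewrite starB hs star1.
pose r := Num.sqrt (2 : R); have r2 : r * r = 2.
  by rewrite -expr2 sqr_sqrtr.
clearbody r; pose y := r%:S * (x * w).
have yE : star y * y = 2 * (h * (w * w)).
  have hw : h * w = w * h by rewrite /w mulrBr mulrBl mulr1 mul1r.
  rewrite /y !starM starS ws [2]natSE -r2 realSM /h.
  rewrite [_ * (r%:S * _)]mulrA -[_ * r%:S * r%:S]mulrA -realSM.
  rewrite mulr_algr -scalerAl mulr_algl; congr (_ *: _).
  by rewrite mulrA -[w * _ * x]mulrA -/h -hw mulrA.
have y1 : nm y <= 1.
  apply: pos_1B_starM; apply: pos_half.
  rewrite yE [X in pos X](_ : _ =
      (1 - h ^+ 4) + (w * w) * (w * w) + (2 * (h * h))); last first.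
    have E : 2 * (1 - 2 * ('X * ((1 - 'X) * (1 - 'X)))) = (1 - 'X ^+ 4) +
      ((1 - 'X) * (1 - 'X)) * ((1 - 'X) * (1 - 'X)) + (2 * ('X * 'X))
      :> {poly R[i]} by ring.
    by move: E => /(congr1 (horner_alg h)); rewrite !halgE.
  apply: posD; last first.
    by rewrite natSE; apply: posZ => //; exact: pos_sqr.
  apply: posD; last by apply: pos_sqr; rewrite starM ws.
  have := pos_SB (h := h ^+ 4) (t := 1); rewrite realSE; apply.
    by rewrite starX hs.
  by rewrite (le_trans (nmX _ _)) // exprn_ile1 ?nm_ge0.
have {IHn} := IHn y y1; rewrite yE exprS; set e := 2^-1 ^+ n => ye.
have e0 : 0 <= e by rewrite exprn_ge0 ?invr_ge0.
case: (lerP (nm w) 1) => W1; first by lra.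
(* This uses [2 * w ^+ 3 = (1 - star y * y) + (2 * w ^+ 2 - 1)]. With [W := nm w] it yields
   [2 * (W ^+ 3 - W ^+ 2) <= e], and [W ^+ 3 - W ^+ 2 >= W - 1] then halves the excess. *)
have : nm (2 * w ^+ 3) <= 1 + e + (2 * nm w ^+ 2 - 1).
  rewrite (_ : 2 * w ^+ 3 = (1 - 2 * (h * (w * w))) +
    ((nm w ^+ 2 - 1)%:S - ((nm w ^+ 2)%:S - 2 * (w * w)))); last first.
    have -> (d : R) : (d - 1)%:S - (d%:S - 2 * (w * w)) = 2 * (w * w) - 1.
      by rewrite !realSE opprB addrC addrA subrK.
    have E : 2 * (1 - 'X) ^+ 3 = (1 - 2 * ('X * ((1 - 'X) * (1 - 'X)))) +
      (2 * ((1 - 'X) * (1 - 'X)) - 1) :> {poly R[i]} by ring.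
    by move: E => /(congr1 (horner_alg h)); rewrite !halgE.
  rewrite (le_trans (nmD _ _)) // lerD //.
  rewrite (le_trans (nmB _ _)) // nmS ger0_norm; last first.
    by rewrite subr_ge0 exprn_ege1 // ltW.
  suff : nm ((nm w ^+ 2)%:S - 2 * (w * w)) <= nm w ^+ 2 by lra.
  apply: pos_nm.
    by rewrite natSE; apply: posZ => //; exact: pos_sqr.
  by rewrite nm_natl -expr2 nm_sa_sqr.
rewrite nm_natl nm_saX // => W3.
have : 0 <= (nm w - 1) * (nm w ^+ 2 - 1).
  by rewrite mulr_ge0 ?subr_ge0 ?exprn_ege1 // ltW.
have -> : (nm w - 1) * (nm w ^+ 2 - 1) = nm w ^+ 3 - nm w ^+ 2 - nm w + 1 by ring.
by lra.
Qed.

Lemma nm_1B_starM x : nm x <= 1 -> nm (1 - star x * x) <= 1.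
Proof.
move=> x1; apply/ler_addgt0Pr => e e0.
have [n ne] : exists n, 2^-1 ^+ n <= e.
  exists (Num.trunc e^-1).+1; rewrite exprVn invf_ple ?posrE ?exprn_gt0 //.
  rewrite (le_trans (ltW (truncnS_gt _))) // -natrX ler_nat.
  exact: ltnW (ltn_expl _ (ltnSn 1)).
by rewrite (le_trans (nm_1B_starM_le n x1)) // lerD2l.
Qed.

Lemma pos_starM x : pos (star x * x).
Proof.
split; first exact: starM_sa; exists (nm x ^+ 2); first by rewrite exprn_ge0 ?nm_ge0.
have [x0|x0] := eqVneq (nm x) 0.
  by rewrite (nm_eq0 x0) mulr0 subr0 nm0 nmS expr0n normr0.
set c := nm x in x0 *; have c0 : 0 < c by rewrite lt0r x0 nm_ge0.
have : nm (c^-1%:S * x) <= 1.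
  by rewrite nmSl -/c ger0_norm ?mulVf // invr_ge0 ltW.
move/nm_1B_starM; rewrite starM_S => le1.
have -> : (c ^+ 2)%:S - star x * x =
    (c ^+ 2)%:S * (1 - (c^-1 ^+ 2)%:S * (star x * x)).
  by rewrite mulrBr mulr1 mulrA -realSM -exprMn divff // expr1n realS1 mul1r.
have c20 : 0 <= c ^+ 2 by rewrite exprn_ge0 // ltW.
by rewrite nmSl ger0_norm // ler_piMr.
Qed.

(** * States and the quadratic form *)

(** With [p] and [q] the roots of [a] and [c], the claim is the discriminant bound
    [b <= 2 * p * q]. *)
Lemma sqrt_quadratic_le (a b c : R) : 0 <= a -> 0 <= c ->
  (forall t, 0 <= a + t * b + t ^+ 2 * c) ->
  Num.sqrt (a + b + c) <= Num.sqrt a + Num.sqrt c.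
Proof.
move=> a0 c0; rewrite -{1 2}(sqr_sqrtr a0) -{1 2}(sqr_sqrtr c0).
move: (Num.sqrt a) (Num.sqrt c) (sqrtr_ge0 a) (sqrtr_ge0 c) => p q p0 q0 abc.
rewrite -[p + q]ger0_norm ?addr_ge0 // -sqrtr_sqr ler_wsqrtr //.
suff : b <= 2 * p * q by rewrite sqrrD; lra.
rewrite leNgt; apply/negP; rewrite -subr_gt0; set d := b - _ => d0.
(* The minimising [t = - p / q] is perturbed by [e > 0], which also covers [q = 0]. This [e]
   satisfies [2 * e * (p + q) + 2 * e * e < d], contradicting the resulting bound on [b]. *)
pose e := d / (2 * (p + q) + 2 + d).
have den0 : 0 < 2 * (p + q) + 2 + d by lra.
have eE : e * (2 * (p + q) + 2 + d) = d by rewrite mulfVK ?gt_eqF.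
have e0 : 0 < e by rewrite divr_gt0.
have e1 : e < 1 by rewrite ltr_pdivrMr //; lra.
clearbody e; have := abc (- ((p + e) / (q + e))).
set T := (p + e) / (q + e).
have TE : T * (q + e) = p + e by rewrite mulfVK // gt_eqF //; lra.
have T0 : 0 < T by rewrite divr_gt0 //; lra.
clearbody T; rewrite sqrrN => abcT.
have : T * b <= T * (2 * (p + e) * (q + e)).
  have -> : T * (2 * (p + e) * (q + e)) = (p + e) ^+ 2 + T ^+ 2 * (q + e) ^+ 2.
    by rewrite -exprMn TE -mulrA mulrCA [(p + e) * _]mulrC [T * _]mulrA TE; ring.
  have : p ^+ 2 <= (p + e) ^+ 2 by rewrite lerXn2r ?nnegrE //; lra.
  have : T ^+ 2 * q ^+ 2 <= T ^+ 2 * (q + e) ^+ 2.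
    by rewrite ler_wpM2l ?sqr_ge0 // lerXn2r ?nnegrE //; lra.
  by lra.
rewrite ler_pM2l // => le_b.
have : d <= 2 * e * (p + q) + 2 * e * e by rewrite /d; lra.
have : e * e < e by rewrite gtr_pMr.
have : 0 < e * d by rewrite mulr_gt0.
by move: eE; rewrite !mulrDr; lra.
Qed.

(** The properties of a state that enter the estimates, phrased with [nm] for a bare function
    instead of [normed_space] and [dual_norm]. *)
Definition unital_contraction (g : A -> R[i]) : Prop :=
  [/\ forall x y, g (x + y) = g x + g y, forall z x, g (z *: x) = z * g x,
      g 1 = 1 & forall x, `|g x| <= (nm x)%:C].

Section UnitalContraction.
Context (g : A -> R[i]) (gP : unital_contraction g).

Let gD x y : g (x + y) = g x + g y. Proof. by case: gP. Qed.
Let gZ z x : g (z *: x) = z * g x. Proof. by case: gP. Qed.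
Let g1 : g 1 = 1. Proof. by case: gP. Qed.
Let g_le x : `|g x| <= (nm x)%:C. Proof. by case: gP. Qed.

Let g_sqr_le x : complex.Re (g x) ^+ 2 + complex.Im (g x) ^+ 2 <= nm x ^+ 2.
Proof.
rewrite -lecR add_Re2_Im2 (rmorphXn (real_complex R)) /=.
by apply: lerXn2r => //; rewrite nnegrE ?normr_ge0 ?ler0c ?nm_ge0.
Qed.

Lemma contraction_Re_le x : complex.Re (g x) <= nm x.
Proof.
by rewrite (le_trans (ler_norm _)) // -lecR (le_trans (normc_ge_Re _)).
Qed.

(* If [g h] had imaginary part [b != 0], then [`|g (h + 'i t)| >= `|b + t|] would
   exceed [nm (h + 'i t) <= sqrt (nm h ^+ 2 + t ^+ 2)] for a suitable [t]. *)
Lemma contraction_Im_sa h : star h = h -> complex.Im (g h) = 0.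
Proof.
move=> hs; have [//|b0] := eqVneq (complex.Im (g h)) 0.
set b := complex.Im (g h) in b0.
(* Now [2 * b * t = nm h ^+ 2 + 1], so [(b + t) ^+ 2 > nm h ^+ 2 + t ^+ 2]. *)
pose t := (nm h ^+ 2 + 1) / (2 * b).
have it2 : Num.conj ('i * t%:C) = - ('i * t%:C) :> R[i].
  rewrite (rmorphM Num.conj) /= conjCi mulNr conj_Creal //.
  by apply/complex_realP; exists t.
have zz : Num.conj ('i * t%:C) * ('i * t%:C) = (t ^+ 2)%:C :> R[i].
  by rewrite it2 mulNr mulrACA -!expr2 sqrCi mulN1r opprK -(rmorphXn (real_complex R)).
have := g_sqr_le (h + ('i * t%:C) *: 1).
rewrite -nm_starM starD starZ star1 hs.
rewrite mulrDl !mulrDr -!scalerAl -!scalerAr !mulr1 !mul1r scalerA zz.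
rewrite it2 scaleNr [X in nm X](_ : _ = h * h + (t ^+ 2)%:S); last first.
  by rewrite addrA addrK.
move=> /le_trans/(_ (nmD _ _)); rewrite nmS ger0_norm ?sqr_ge0 //.
rewrite gD gZ g1 mulr1 -complexiE.
have := nmM h h; have tE : t * (2 * b) = nm h ^+ 2 + 1.
  by rewrite mulfVK // mulf_neq0 // pnatr_eq0.
clearbody t; move: tE; rewrite /b; case: (g h) => [u v] /=.
rewrite !(mul0r, mul1r, mulr0, addr0, add0r, subr0, oppr0) => tE.
have := sqr_ge0 u; have := sqr_ge0 v; nra.
Qed.

(** The real part of [g (t - h)] is [t] minus that of [g h], and is at most [nm (t - h) <= t]. *)
Lemma contraction_pos h : pos h -> 0 <= complex.Re (g h).
Proof.
case=> hs [t t0 ht]; have := contraction_Re_le (t%:S - h).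
rewrite gD gZ g1 mulr1 -scaleN1r gZ mulN1r.
by rewrite scaleN1r; case: (g h) => [u v] /=; lra.
Qed.

(** The radicand of [nabla_norm] as a real quadratic form; [sqrtC_nabla] justifies taking the real
    part. *)
Definition nabla_form x : R :=
  (complex.Re (g x) ^+ 2 + complex.Im (g x) ^+ 2 + complex.Re (g (star x * x))) / 2.

Lemma nabla_form_ge0 x : 0 <= nabla_form x.
Proof.
by rewrite divr_ge0 // !addr_ge0 ?sqr_ge0 // contraction_pos //; exact: pos_starM.
Qed.

Lemma nabla_form_le x : nabla_form x <= nm x ^+ 2.
Proof.
have := g_sqr_le x; have := contraction_Re_le (star x * x).
by rewrite nm_starM /nabla_form; lra.
Qed.

Lemma nabla_formD x y : exists b, forall t : R,
  nabla_form (x + t%:C *: y) = nabla_form x + t * b + t ^+ 2 * nabla_form y.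
Proof.
exists (complex.Re (g x) * complex.Re (g y) + complex.Im (g x) * complex.Im (g y)
  + complex.Re (g (star x * y) + g (star y * x)) / 2) => t.
rewrite /nabla_form starD starZ conj_Creal; last by apply/complex_realP; exists t.
have -> : (star x + t%:C *: star y) * (x + t%:C *: y) = star x * x +
    t%:C *: (star x * y) + (t%:C *: (star y * x) + t%:C *: (t%:C *: (star y * y))).
  by rewrite mulrDl !mulrDr -!scalerAl -!scalerAr.
rewrite !gD !gZ.
case: (g x) (g y) => [x1 x2] [y1 y2]; case: (g (star x * x)) => [a1 a2].
case: (g (star y * y)) => [b1 b2]; case: (g (star x * y)) => [c1 c2].
case: (g (star y * x)) => [d1 d2].
by rewrite /=; field.
Qed.

Lemma sqrtC_nabla x :
  sqrtC (2^-1 * (`|g x| ^+ 2 + g (star x * x))) = (Num.sqrt (nabla_form x))%:C.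
Proof.
have sqrtE : (Num.sqrt (nabla_form x))%:C ^+ 2 = (nabla_form x)%:C.
  by rewrite -[in RHS](sqr_sqrtr (nabla_form_ge0 x)) (rmorphXn (real_complex R)).
rewrite -[RHS]sqrCK ?ler0c ?sqrtr_ge0 // sqrtE -add_Re2_Im2; congr sqrtC.
have := contraction_Im_sa (starM_sa x); rewrite /nabla_form.
rewrite mulrC (rmorphM (real_complex R)) (fmorphV (real_complex R)) rmorph_nat.
case: (g (star x * x)) => [y1 y2] /= ->.
by rewrite !(rmorphD (real_complex R)).
Qed.

Lemma sqrt_nabla_formD x y : Num.sqrt (nabla_form (x + y)) <=
  Num.sqrt (nabla_form x) + Num.sqrt (nabla_form y).
Proof.
have [b bE] := nabla_formD x y.
have q0 t : 0 <= nabla_form x + t * b + t ^+ 2 * nabla_form y.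
  by rewrite -bE nabla_form_ge0.
have := bE 1; rewrite scale1r mul1r expr1n mul1r => ->.
exact: sqrt_quadratic_le (nabla_form_ge0 x) (nabla_form_ge0 y) q0.
Qed.

End UnitalContraction.

(* [sup] is [0] on sets without a supremum, so [dual_norm f = 1] already says that
   the supremum exists. *)
Lemma states_contraction (f : {linear normed_space A -> R[i]^o}) :
  states A f -> unital_contraction f.
Proof.
case=> _ f1 fn; split => [x y|z x||x] //; first exact: (raddfD f).
  exact: (linearZ_LR f z x).
move: fn; rewrite /dual_norm /csup; set E := (X in sup X).
have [hE|/sup_out -> /eqP] := pselect (has_sup E); last first.
  by rewrite eq_sym oner_eq0.
move=> E1.
have [x0|x0] := eqVneq (nm x) 0.
  by rewrite (nm_eq0 x0) (raddf0 f) normr0 ler0c nm_ge0.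
have c0 : 0 < nm x by rewrite lt0r x0 nm_ge0.
set c := nm x in x0 c0 *.
pose v : normed_space A := c^-1%:C *: (x : normed_space A).
have xv : (x : normed_space A) = c%:C *: v.
  by rewrite scalerA -(rmorphM (real_complex R)) divff // scale1r.
have v1 : `|v| <= 1.
  have -> : `|v| = (nm (c^-1%:C *: x))%:C := nmE _.
  rewrite nmZ normc_def /= expr0n addr0 sqrtr_sqr -(rmorphM (real_complex R)).
  by rewrite ger0_norm ?mulVf // invr_ge0 ltW.
have fvE : (complex.Re `|f v|)%:C = `|f v| by rewrite RRe_real // normr_real.
have Ev : E (complex.Re `|f v|) by exists v.
have := sup_upper_bound hE Ev; rewrite E1 -lecR fvE => fv.
rewrite xv (linearZ_LR f) normrM.
have -> : `|c%:C| = c%:C :> R[i] by rewrite ger0_norm // ler0c ltW.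
by rewrite ler_piMr // ler0c ltW.
Qed.

(** * Suprema over the states *)

Lemma nabla_normE x : nabla_norm x =
  sup [set Num.sqrt (nabla_form f x) | f in states A]%classic.
Proof.
rewrite /nabla_norm /csup; congr sup; apply/seteqP; split => r /=.
  case=> f fs; rewrite (sqrtC_nabla (states_contraction fs)) => /complexI <-.
  by exists f.
by case=> f fs <-; exists f; rewrite ?(sqrtC_nabla (states_contraction fs)).
Qed.

Lemma nabla_norm_ub (f : {linear normed_space A -> R[i]^o}) x :
  states A f -> Num.sqrt (nabla_form f x) <= nabla_norm x.
Proof.
move=> fs; rewrite nabla_normE; apply: sup_upper_bound; last by exists f.
split; first by exists (Num.sqrt (nabla_form f x)), f.
exists (nm x) => _ [k ks <-].
rewrite -[nm x]ger0_norm ?nm_ge0 // -sqrtr_sqr ler_wsqrtr //.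
exact: nabla_form_le (states_contraction ks) x.
Qed.

End RealNorm.

Theorem proposition2p3 (R : realType) (A : cstarAlgType R) (a b : A) :
  nabla_norm (a + b) <= nabla_norm a + nabla_norm b.
Proof.
(* Without states both sides are [sup set0 = 0]. *)
have [[f0 f0s]|no_state] := pselect (exists f, states A f); last first.
  have nabla0 (x : A) : nabla_norm x = 0.
    rewrite nabla_normE (_ : [set _ | _ in _]%classic = set0) ?sup0 //.
    by apply/seteqP; split=> // r [f fs _]; case: no_state; exists f.
  by rewrite !nabla0 addr0.
rewrite nabla_normE; apply: ge_sup.
  by exists (Num.sqrt (nabla_form f0 (a + b))), f0.
move=> _ [f fs <-]; have := sqrt_nabla_formD (states_contraction fs) a b.
by move/le_trans; apply; apply: lerD; exact: nabla_norm_ub.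
Qed.
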